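(* Let $\|\cdot\|_*$ be a fixed matrix norm on $\mathfrak g$. If $\|f(Z)-f(Z^{-1})\|_*\le C$ for all $Z\in G$, then for all $X\in G^n$ $$\|F(X)\|_{*,\ell^\infty}\le\frac C2\,\|\Gamma\|_\infty,\qquad\text{where } \|M\|_\infty=\max_{i=1,\dots,n}\sum_{j=1}^n|M_{ij}|.$$
   Context: Let $G$ be a matrix Lie group (closed subgroup of the general linear group over $\mathbb R$ or $\mathbb C$) with Lie algebra $\mathfrak g$, with the Lohe closure property: $Z-Z^{-1}\in\mathfrak g$ for all $Z\in G$. Let $\Gamma$ be an undirected weighted graph on $n$ vertices with weights $\gamma_{ij}=\gamma_{ji}\ge 0$; $\Gamma$ also denotes the $n\times n$ weight matrix $(\gamma_{ij})$. Let $f(x)=\sum_{p\ge1}a_px^p$ be real analytic with real coefficients, applied to matrices by its power series, with radius of convergence exceeding the spectral radius of every element of $G$. Define $F:G^n\to\mathfrak g^n$ by $$F_i(X)=\frac12\sum_{j=1}^n\gamma_{ij}\bigl(f(X_jX_i^{-1})-f(X_iX_j^{-1})\bigr).$$ For $\mathcal Q=(Q_1,\dots,Q_n)\in\mathfrak g^n$ put $\|\mathcal Q\|_{*,\ell^\infty}=\max_{i=1,\dots,n}\|Q_i\|_*$. *)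

(* Defs.v *)
From mathcomp Require Import all_boot all_order all_algebra.
From mathcomp Require Import complex.
From mathcomp Require Import all_classical all_reals all_analysis.

Set Implicit Arguments.
Unset Strict Implicit.
Unset Printing Implicit Defensive.

Import Order.TTheory GRing.Theory Num.Theory.
Import numFieldNormedType.Exports.

Local Open Scope classical_set_scope.
Local Open Scope ring_scope.

Inductive base_field := Reals | Complexes.

Definition scalars (R : realType) (b : base_field) : numFieldType :=
  match b with Reals => R | Complexes => R[i] end.

Definition of_real (R : realType) (b : base_field) : R -> scalars R b :=
  match b return R -> scalars R b with
  | Reals => fun x => x
  | Complexes => fun x => x%:C%C
  end.

Definition to_complex (R : realType) (b : base_field) : scalars R b -> R[i] :=
  match b return scalars R b -> R[i] with
  | Reals => fun x => x%:C%C
  | Complexes => fun z => z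
  end.

Section MatrixFunctions.
Variables (R : realType) (b : base_field) (d : nat).
Local Notation K := (scalars R b).
Implicit Types (A Z : 'M[K]_d) (c : nat -> R).

(* The limit is taken in the usual (entrywise) topology of matrices; it is
   meaningful only when the series converges. *)
Definition mx_pseries c A : 'M[K]_d :=
  limn (series (fun p : nat => of_real b (c p) *: A ^+ p)).

Definition expmx A : 'M[K]_d := mx_pseries (fun p => (p`!%:R)^-1) A.

(* Eigenvalues are complex, also when the matrix is real. *)
Definition spectral_radius Z : R :=
  sup [set Normc.normc z | z in
        [set z : R[i] | eigenvalue (map_mx (@to_complex R b) Z) z]].

Definition convergence_radius c : \bar R :=
  ereal_sup [set r%:E | r in [set r : R | 0 <= r /\ cvgn (pseries c r)]].

Record matrix_lie_group (G : set 'M[K]_d) : Prop := MatrixLieGroup {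
  mlg_unit : forall A, G A -> A \in unitmx;
  mlg_one : G 1%:M;
  mlg_mul : forall A B, G A -> G B -> G (A *m B);
  mlg_inv : forall A, G A -> G (invmx A);
  (* closed in the general linear group, not necessarily in 'M_d *)
  mlg_closed : exists2 F : set 'M[K]_d,
    closed F & G = F `&` [set A | A \in unitmx]
}.

(* A real Lie algebra, also over the complex numbers. *)
Definition lie_algebra (G : set 'M[K]_d) : set 'M[K]_d :=
  [set A | forall t : R, G (expmx (of_real b t *: A))].

Definition lohe_closure (G : set 'M[K]_d) : Prop :=
  forall Z, G Z -> lie_algebra G (Z - invmx Z).

(* N is a norm on the real vector space g; its values outside g are
   irrelevant. *)
Record norm_on (g : set 'M[K]_d) (N : 'M[K]_d -> R) : Prop := NormOn {
  norm_on_ge0 : forall A, g A -> 0 <= N A;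
  norm_on_eq0 : forall A, g A -> N A = 0 -> A = 0;
  norm_onZ : forall (t : R) A, g A -> N (of_real b t *: A) = `|t| * N A;
  norm_onD : forall A B, g A -> g B -> N (A + B) <= N A + N B
}.

End MatrixFunctions.

Record weighted_graph (R : realType) (n : nat) := WeightedGraph {
  weight_mx :> 'M[R]_n;
  weight_sym : forall i j, weight_mx i j = weight_mx j i;
  weight_ge0 : forall i j, 0 <= weight_mx i j
}.

Definition lohe_field (R : realType) (b : base_field) (d n : nat)
    (Gamma : weighted_graph R n) (f : 'M[scalars R b]_d -> 'M[scalars R b]_d)
    (X : 'I_n -> 'M[scalars R b]_d) (i : 'I_n) : 'M[scalars R b]_d :=
  of_real b 2^-1 *:
    \sum_(j < n) of_real b (Gamma i j) *:
      (f (X j *m invmx (X i)) - f (X i *m invmx (X j))).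

Definition max_norm (R : realType) (n : nat) (T : Type) (N : T -> R)
    (Q : 'I_n -> T) : R :=
  \big[Num.max/0]_(i < n) N (Q i).

Definition mx_norm_infty (R : realType) (n : nat) (M : 'M[R]_n) : R :=
  \big[Num.max/0]_(i < n) \sum_(j < n) `|M i j|.

(* Main.v *)
Require Import Defs.
From HB Require Import structures.
From mathcomp Require Import all_boot all_order all_algebra.
From mathcomp Require Import complex lra.
From mathcomp Require Import all_classical all_reals all_analysis.

(** Write [D Z] for [f(Z) - f(Z^-1)] and [g] for the Lie algebra of [G]. With
    [Z_j = X_j X_i^-1], the i-th component of [F(X)] is half the sum over [j] of
    [Gamma_ij D(Z_j)], so the bound is the triangle inequality followed by
    [N (D Z_j) <= C] and by the bound of a row sum by the largest one.

    The triangle inequality for [N] holds only inside [g], and most of the work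
    goes into staying inside [g].

    - [g] is a real vector space ([lie_algebraD]). For [A], [B] in [g] the
      product [H_m = exp(A/m) exp(B/m)] lies in [G] and equals
      [1 + (A+B)/m + o(1/m)], so its m-th power tends to [exp(A+B)]. The group is
      closed among invertible matrices, and exponentials are invertible, so
      [exp(A+B)] is in [G]. Replacing [A], [B] by [tA], [tB] gives [A + B] in
      [g].

    - [g] is closed under limits ([lie_algebra_cvg]), because the exponential is
      continuous.

    - [D Z] is in [g] ([lie_algebra_pseries_diff]): it is the limit of the sums
      of [a_p (Z^p - Z^-p)], and [Z^p - (Z^p)^-1] is in [g] by the closure property
      applied to [Z^p].

    The last point requires that both power series converge
    ([mx_pseries_cvg]). If [r] exceeds the spectral radius of [Z] then [Z^p] is
    [O(r^p)] ([mxexp_growth]); this follows from the Cayley-Hamilton theorem by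
    removing the linear factors of the characteristic polynomial one at a time.

    The limits involving the exponential rest on one dominated convergence
    theorem for series ([tannery]), applied to the series of [exp], to the
    binomial expansion of [(1 + A_m/m)^m], and to [m (exp(A/m) - 1)]. *)

Import Order.TTheory GRing.Theory Num.Theory.
Import numFieldNormedType.Exports.

Local Open Scope classical_set_scope.
Local Open Scope ring_scope.

Set Implicit Arguments.
Unset Strict Implicit.

(** * Real-valued norms over real or complex scalars *)

Section RealNorm.
Variables (R : realType) (b : base_field).
Local Notation K := (scalars R b).

Lemma of_real_is_zmod : zmod_morphism (@of_real R b).
Proof. by case: b => x y //=; rewrite rmorphB. Qed.
Lemma of_real_is_monoid : monoid_morphism (@of_real R b).
Proof. by case: b; split => //= x y; rewrite rmorphM. Qed.
HB.instance Definition _ := GRing.isZmodMorphism.Build R K (@of_real R b)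
  of_real_is_zmod.
HB.instance Definition _ := GRing.isMonoidMorphism.Build R K (@of_real R b)
  of_real_is_monoid.

Lemma to_complex_is_zmod : zmod_morphism (@to_complex R b).
Proof. by case: b => x y //=; rewrite rmorphB. Qed.
Lemma to_complex_is_monoid : monoid_morphism (@to_complex R b).
Proof. by case: b; split => //= x y; rewrite rmorphM. Qed.
HB.instance Definition _ := GRing.isZmodMorphism.Build K R[i] (@to_complex R b)
  to_complex_is_zmod.
HB.instance Definition _ := GRing.isMonoidMorphism.Build K R[i] (@to_complex R b)
  to_complex_is_monoid.

Lemma ler_of_real (x y : R) : (of_real b x <= of_real b y) = (x <= y).
Proof. by case: b => //=; rewrite lecR. Qed.

Lemma ltr_of_real (x y : R) : (of_real b x < of_real b y) = (x < y).
Proof. by case: b => //=; rewrite ltcR. Qed.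

Lemma of_real_inj : injective (@of_real R b).
Proof. exact: fmorph_inj. Qed.

Lemma norm_of_real (t : R) : `|of_real b t| = of_real b `|t|.
Proof. by case: b => //=; rewrite normc_def /= expr0n addr0 sqrtr_sqr. Qed.

Lemma ge0_of_real (x : K) : 0 <= x -> of_real b (complex.Re (to_complex x)) = x.
Proof.
by case: b x => //= -[x y]; rewrite lecE /= => /andP[/eqP -> _].
Qed.

(** Norms of the library take values in the scalar field, which may be complex.
    Comparison of series needs bounds in the complete ordered field [R]. *)
Definition rnorm (V : normedZmodType K) (v : V) : R :=
  complex.Re (to_complex `|v|).

Section NormedZmod.
Variable V : normedZmodType K.
Implicit Types v w : V.

Lemma rnormE v : of_real b (rnorm v) = `|v|.
Proof. exact: ge0_of_real. Qed.

Lemma rnorm_ge0 v : 0 <= rnorm v.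
Proof. by rewrite -ler_of_real rnormE rmorph0. Qed.

Lemma rnorm0 : rnorm (0 : V) = 0.
Proof. by apply: of_real_inj; rewrite rnormE rmorph0 normr0. Qed.

Lemma rnormD v w : rnorm (v + w) <= rnorm v + rnorm w.
Proof. by rewrite -ler_of_real rmorphD /= !rnormE ler_normD. Qed.

Lemma rnormN v : rnorm (- v) = rnorm v.
Proof. by apply: of_real_inj; rewrite !rnormE normrN. Qed.

Lemma rdistC v w : rnorm (v - w) = rnorm (w - v).
Proof. by rewrite -rnormN opprB. Qed.

Lemma rnorm_sum (I : Type) (r : seq I) (P : pred I) (F : I -> V) :
  rnorm (\sum_(i <- r | P i) F i) <= \sum_(i <- r | P i) rnorm (F i).
Proof.
elim/big_ind2: _ => [|v x w y hv hw|//]; first by rewrite rnorm0.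
exact: le_trans (rnormD _ _) (lerD hv hw).
Qed.

End NormedZmod.

Lemma rnorm_of_real (t : R) : rnorm (of_real b t) = `|t|.
Proof. by apply: of_real_inj; rewrite rnormE norm_of_real. Qed.

Lemma rnormM (x y : K) : rnorm (x * y) = rnorm x * rnorm y.
Proof. by apply: of_real_inj; rewrite rmorphM /= !rnormE normrM. Qed.

Lemma rnormZ (V : normedModType K) (k : K) (v : V) :
  rnorm (k *: v) = rnorm k * rnorm v.
Proof. by apply: of_real_inj; rewrite rmorphM /= !rnormE normrZ. Qed.

Lemma cvg_rnormP (V : normedModType K) T (F : set_system T) {FF : Filter F}
    (u : T -> V) (l : V) :
  u @ F --> l <-> rnorm (l - u x) @[x --> F] --> (0 : R).
Proof.
split=> [/cvgrPdist_lt h|/cvgrPdist_lt h]; apply/cvgrPdist_lt => e e0.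
- have := h (of_real b e); rewrite -(rmorph0 (@of_real R b)) ltr_of_real.
  move=> /(_ e0); apply: filterS => x.
  by rewrite -rnormE ltr_of_real sub0r normrN ger0_norm // rnorm_ge0.
- have e0' := ge0_of_real (ltW e0).
  have /h : 0 < complex.Re (to_complex e).
    by rewrite -ltr_of_real rmorph0 e0'.
  apply: filterS => x; rewrite sub0r normrN ger0_norm ?rnorm_ge0 //.
  by rewrite -ltr_of_real rnormE e0'.
Qed.

Lemma cvg_rnorm (V : normedModType K) T (F : set_system T) {FF : Filter F}
    (u : T -> V) (l : V) :
  u @ F --> l -> rnorm (u x) @[x --> F] --> rnorm l.
Proof.
move=> /cvg_rnormP/cvgrPdist_lt h; apply/cvgrPdist_lt => e /h; apply: filterS => x.
rewrite sub0r normrN ger0_norm ?rnorm_ge0 //; apply: le_lt_trans.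
rewrite ler_norml; apply/andP; split.
  rewrite lerNl opprB lerBlDr -[X in rnorm X <= _](subrK l) rdistC.
  exact: rnormD.
by rewrite lerBlDr -[X in rnorm X <= _](subrK (u x)) rnormD.
Qed.

Lemma to_complex_norm (x : K) : to_complex `|x| = `|to_complex x|.
Proof. by case: b x => //= x; rewrite normc_def /= expr0n addr0 sqrtr_sqr. Qed.

Lemma rnorm_ge_Re (x : K) : `|complex.Re (to_complex x)| <= rnorm x.
Proof.
by rewrite /rnorm to_complex_norm -lecR (le_trans (normc_ge_Re _)) ?normc_def.
Qed.

Lemma rnorm_ge_Im (x : K) : `|complex.Im (to_complex x)| <= rnorm x.
Proof.
rewrite /rnorm to_complex_norm -sqrtr_sqr normc_def /=.
by apply: ler_wsqrtr; rewrite lerDr sqr_ge0.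
Qed.

Lemma rnorm_le_ReIm (x : K) :
  rnorm x <= `|complex.Re (to_complex x)| + `|complex.Im (to_complex x)|.
Proof.
rewrite /rnorm to_complex_norm normc_def /=.
set p := complex.Re _; set q := complex.Im _.
rewrite -(@ler_sqr R) ?nnegrE ?sqrtr_ge0 ?addr_ge0 //.
rewrite sqr_sqrtr ?addr_ge0 ?sqr_ge0 // sqrrD !real_normK ?num_real //.
by rewrite lerD2r lerDl mulrn_wge0 // mulr_ge0.
Qed.

(** Completeness of the complex numbers, reduced to that of [R] through real and
    imaginary parts. *)
Lemma cvg_scalars (u : nat -> K) (r i : R) :
  complex.Re (to_complex (u n)) @[n --> \oo] --> r ->
  complex.Im (to_complex (u n)) @[n --> \oo] --> i -> cvgn u.
Proof.
move=> hr hi.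
have [l lE] : exists l : K, to_complex l = (r +i* i)%C.
  case: b u hr hi => [|] u hr hi; last by exists (r +i* i)%C.
  (* The imaginary parts vanish for real scalars, and so does their limit. *)
  exists r => /=; congr (_ +i* _)%C.
  exact: (cvg_unique _ (cvg_cst 0) hi).
apply/cvg_ex; exists l; apply/(@cvg_rnormP K^o).
apply: (@squeeze_cvgr _ _ _ _ (fun=> 0)
  (fun n => `|r - complex.Re (to_complex (u n))|
            + `|i - complex.Im (to_complex (u n))|)).
- apply: nearW => n; rewrite rnorm_ge0 /=; apply: le_trans (rnorm_le_ReIm _) _.
  by rewrite rmorphB /= lE; case: (to_complex (u n)).
- exact: cvg_cst.
- rewrite -[X in _ --> X](addr0 0); apply: cvgD.
    by rewrite -(normr0 R) -(subrr r); apply: cvg_norm; apply: cvgB => //;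
      exact: cvg_cst.
  by rewrite -(normr0 R) -(subrr i); apply: cvg_norm; apply: cvgB => //;
    exact: cvg_cst.
Qed.

Lemma cvg_series_scalars (u : nat -> K) :
  cvgn (series (fun n => rnorm (u n))) -> cvgn (series u).
Proof.
move=> h.
have hr : cvgn (series (fun n => complex.Re (to_complex (u n)))).
  apply: (@normed_cvg R R^o); apply: series_le_cvg h => n //=;
    [exact: rnorm_ge0 | exact: rnorm_ge_Re].
have hi : cvgn (series (fun n => complex.Im (to_complex (u n)))).
  apply: (@normed_cvg R R^o); apply: series_le_cvg h => n //=;
    [exact: rnorm_ge0 | exact: rnorm_ge_Im].
have ReS n : complex.Re (to_complex (series u n)) =
    series (fun n => complex.Re (to_complex (u n))) n.
  by rewrite /series /= !raddf_sum.
have ImS n : complex.Im (to_complex (series u n)) =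
    series (fun n => complex.Im (to_complex (u n))) n.
  by rewrite /series /= !raddf_sum.
apply: cvg_scalars.
- by under eq_fun do rewrite ReS; exact: hr.
- by under eq_fun do rewrite ImS; exact: hi.
Qed.

Lemma cvg_mxP m n T (F : set_system T) {FF : Filter F}
    (u : T -> 'M[K]_(m, n)) (A : 'M[K]_(m, n)) :
  u @ F --> A <-> forall i j, u x i j @[x --> F] --> A i j.
Proof.
split=> [h i j|h].
  exact: (cvg_comp u (fun M : 'M[K]_(m, n) => M i j) h
           (@coord_continuous K m n i j A)).
apply/cvg_ballP => e e0.
have : \forall x \near F, forall ij : 'I_m * 'I_n, ball (A ij.1 ij.2) e (u x ij.1 ij.2).
  by apply: filter_forall => -[i j]; exact: (cvg_ball (h i j) e0).
by apply: filterS => x hx; split=> // i j; exact: (hx (i, j)).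
Qed.

Lemma rnorm_entry m n (A : 'M[K]_(m, n)) i j : rnorm (A i j) <= rnorm A.
Proof.
rewrite -ler_of_real !rnormE [leRHS]/Num.Def.normr /= mx_normE.
by rewrite -[leLHS]nngE num_le; apply: (le_bigmax _ _ (i, j)).
Qed.

Lemma rnorm_mx_le m n (A : 'M[K]_(m, n)) (c : R) : 0 <= c ->
  (forall i j, rnorm (A i j) <= c) -> rnorm A <= c.
Proof.
move=> c0 h; rewrite -ler_of_real rnormE -[`|A|]/(mx_norm A).
have [->|/mx_norm_neq0 [[i j] ->]] := eqVneq (mx_norm A) 0.
  by rewrite -(rmorph0 (@of_real R b)) ler_of_real.
by rewrite -rnormE ler_of_real.
Qed.

(** The matrix norm is the largest entry, hence the factor [d]. *)
Lemma rnorm_mulmx d (A B : 'M[K]_d) :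
  rnorm (A *m B) <= d%:R * rnorm A * rnorm B.
Proof.
apply: rnorm_mx_le => [|i j]; first by rewrite !mulr_ge0 ?rnorm_ge0.
rewrite mxE; apply: le_trans (rnorm_sum _ _ _) _.
rewrite -mulrA mulr_natl -[X in _ *+ X](card_ord d) -sumr_const.
by apply: ler_sum => k _; rewrite rnormM ler_pM ?rnorm_ge0 ?rnorm_entry.
Qed.

(** The exponent 0 is included because the identity has norm at most 1. *)
Lemma rnorm_mxexp d (A : 'M[K]_d) p : rnorm (A ^+ p) <= (d%:R * rnorm A) ^+ p.
Proof.
elim: p => [|p IH].
  rewrite !expr0; apply: rnorm_mx_le => // i j; rewrite mxE.
  rewrite -(rmorph_nat (@of_real R b)) rnorm_of_real.
  by case: eqP; rewrite ?normr0 ?normr1.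
rewrite !exprS; apply: le_trans (rnorm_mulmx _ _) _.
by rewrite ler_wpM2l // mulr_ge0 ?rnorm_ge0.
Qed.

Lemma cvg_mulmx d T (F : set_system T) {FF : Filter F}
    (u v : T -> 'M[K]_d) (A B : 'M[K]_d) :
  u @ F --> A -> v @ F --> B -> u x *m v x @[x --> F] --> A *m B.
Proof.
move=> /cvg_mxP hu /cvg_mxP hv; apply/cvg_mxP => i j.
under eq_fun do rewrite mxE.
rewrite mxE; apply: cvg_big => [|k _]; first exact: add_continuous.
exact: (cvgM (hu i k) (hv k j)).
Qed.

Lemma cvg_mxexp d T (F : set_system T) {FF : Filter F}
    (u : T -> 'M[K]_d) (A : 'M[K]_d) p :
  u @ F --> A -> u x ^+ p @[x --> F] --> A ^+ p.
Proof.
move=> h; elim: p => [|p IH]; first exact: cvg_cst.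
rewrite exprS; under eq_fun do rewrite exprS.
exact: cvg_mulmx.
Qed.

Lemma cvg_series_mx m n (u : nat -> 'M[K]_(m, n)) :
  cvgn (series (fun p => rnorm (u p))) -> cvgn (series u).
Proof.
move=> h.
have hij i j : cvgn (series (fun p => u p i j)).
  apply: cvg_series_scalars; apply: series_le_cvg h => p;
    [exact: rnorm_ge0 | exact: rnorm_ge0 | exact: rnorm_entry].
apply/cvg_ex; exists (\matrix_(i, j) limn (series (fun p => u p i j))).
apply/cvg_mxP => i j; rewrite mxE.
have -> : (fun p => series u p i j) = series (fun p => u p i j).
  by apply/funext => p; rewrite /series /= summxE.
exact: hij.
Qed.

End RealNorm.

(** * Dominated convergence for series *)

Section Tannery.
Variables (R : realType) (b : base_field) (V : normedModType (scalars R b)).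
Implicit Types (u : nat -> V) (c : nat -> R).

Lemma rnorm_tail_le u c U n : (forall p, rnorm (u p) <= c p) ->
  cvgn (series c) -> series u @ \oo --> U ->
  rnorm (U - series u n) <= limn (series c) - series c n.
Proof.
move=> uc hc hu.
have h1 : rnorm (series u m - series u n) @[m --> \oo] --> rnorm (U - series u n).
  by apply: cvg_rnorm; apply: cvgB => //; exact: cvg_cst.
have h2 : series c m - series c n @[m --> \oo] --> limn (series c) - series c n.
  by apply: cvgB => //; exact: cvg_cst.
apply: ler_cvg_to h1 h2 _; near=> m.
have nm : (n <= m)%N by near: m; exact: nbhs_infty_ge.
rewrite !sub_series_geq //; apply: le_trans (rnorm_sum _ _ _) _.
exact: ler_sum.
Unshelve. all: by end_near. Qed.

(** Cut all the series at an index where the tail of the dominating series is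
    below [e / 3]: both tails are then below [e / 3], and the head is a finite
    sum, which converges termwise. *)
Lemma tannery (F : nat -> nat -> V) (L : nat -> V) c (S : nat -> V) (T : V) :
  (forall m p, rnorm (F m p) <= c p) -> cvgn (series c) ->
  (forall p, F m p @[m --> \oo] --> L p) ->
  (forall m, series (F m) @ \oo --> S m) -> series L @ \oo --> T ->
  S @ \oo --> T.
Proof.
move=> Fc hc FL FS LT.
have Lc p : rnorm (L p) <= c p.
  by apply: ler_cvg_to (cvg_rnorm (FL p)) (cvg_cst (c p)) _; exact: nearW.
apply/cvg_rnormP/cvgrPdist_lt => e e0.
have [n hn] : exists n, limn (series c) - series c n < e / 3.
  have e3 : 0 < e / 3 by rewrite divr_gt0.
  have /cvgrPdist_lt/(_ _ e3) [n _ hn] := hc.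
  exists n; apply: le_lt_trans (hn n (leqnn n)); exact: ler_norm.
have : series (F m) n @[m --> \oo] --> series L n.
  rewrite /series /=; apply: cvg_big => [|k _]; [exact: add_continuous | exact: FL].
move=> /cvg_rnormP/cvgrPdist_lt/(_ (e / 3)); rewrite divr_gt0 // => /(_ erefl).
apply: filterS => m; rewrite !sub0r !normrN !ger0_norm ?rnorm_ge0 // => hm.
have -> : T - S m = (T - series L n) + (series L n - series (F m) n)
                  - (S m - series (F m) n).
  by rewrite addrA subrK opprB addrA subrK.
apply: le_lt_trans (rnormD _ _) _; rewrite rnormN.
have -> : e = e / 3 + e / 3 + e / 3.
  by lra.
apply: ler_ltD.
  apply: le_trans (rnormD _ _) _; apply: lerD (ltW hm).
  exact: le_trans (rnorm_tail_le n Lc hc LT) (ltW hn).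
exact: le_lt_trans (rnorm_tail_le n (Fc m) hc (FS m)) hn.
Qed.

End Tannery.

(** * Growth of matrix powers and convergence of matrix power series *)

Section PowerGrowth.
Variable R : realType.
Local Notation C := R[i].
Local Notation normc := (@Normc.normc R).

Lemma normc_ge0 (z : C) : 0 <= normc z.
Proof. by case: z => x y; exact: sqrtr_ge0. Qed.

(** The second term of the maximum is chosen so that
    [M <= M' * (r - normc l)], which is what the induction step consumes. *)
Lemma affine_rec_growth (l : C) (r M : R) (u v : nat -> C) :
  normc l < r -> (forall p, u p.+1 = l * u p + v p) ->
  (forall p, normc (v p) <= M * r ^+ p) ->
  exists M', forall p, normc (u p) <= M' * r ^+ p.
Proof.
move=> lr hu hv; exists (Num.max (normc (u 0%N)) (M / (r - normc l))) => p.
set M' := Num.max _ _.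
have r0 : 0 < r by apply: le_lt_trans lr; exact: normc_ge0.
elim: p => [|p IH]; first by rewrite expr0 mulr1 le_max lexx.
rewrite hu; apply: le_trans (le_normcD _ _) _; rewrite Normc.normcM.
have MM : M <= M' * (r - normc l).
  by rewrite -ler_pdivrMr ?subr_gt0 // le_max lexx orbT.
apply: (@le_trans _ _ (normc l * (M' * r ^+ p) + M' * (r - normc l) * r ^+ p)).
  apply: lerD; first by rewrite ler_wpM2l // normc_ge0.
  by apply: le_trans (hv p) _; rewrite ler_wpM2r // exprn_ge0 // ltW.
by rewrite exprS mulrA -mulrDl mulrBr [M' * normc l]mulrC addrC subrK mulrA.
Qed.

(** If the product of the factors [Z - z] over [z :: s] kills [B], then the
    product over [s] kills [(Z - z) B]. The entries of [Z^p (Z - z) B] are thus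
    controlled by induction, and they are the inhomogeneous part of a recurrence
    of ratio [z] satisfied by the entries of [Z^p B]. *)
Lemma annihilated_power_growth d (Z : 'M[C]_d.+1) (s : seq C) (r : R) :
  {in s, forall z, normc z < r} -> forall B : 'M[C]_d.+1,
  horner_mx Z (\prod_(z <- s) ('X - z%:P)) * B = 0 ->
  forall i j, exists M, forall p, normc ((Z ^+ p * B) i j) <= M * r ^+ p.
Proof.
elim: s => [|z s IH] hs B hB i j.
  exists 0 => p; move: hB; rewrite big_nil rmorph1 mul1r => ->.
  by rewrite mulr0 mxE Normc.normc0 mul0r.
have [M hM] : exists M, forall p,
    normc ((Z ^+ p * ((Z - z%:M) * B)) i j) <= M * r ^+ p.
  apply: IH => [w ws|]; first by apply: hs; rewrite inE ws orbT.
  move: hB; rewrite big_cons mulrC rmorphM rmorphB /= horner_mx_X horner_mx_C.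
  by rewrite mulrA.
apply: (affine_rec_growth (l := z) (v := fun p => (Z ^+ p * ((Z - z%:M) * B)) i j)
  _ _ hM); first by apply: hs; rewrite inE eqxx.
move=> p; rewrite mulrBl mulrBr mulrA -exprSr.
rewrite -[z%:M * B]/(z%:M *m B) mul_scalar_mx -scalerAr.
rewrite [X in _ = _ + X]mxE [X in _ = _ + (_ + X)]mxE.
by rewrite [X in _ = _ + (_ - X)]mxE addrC subrK.
Qed.

(** A supremum bounds its set only when that set is bounded above; here it is
    finite, since eigenvalues are roots of the characteristic polynomial. *)
Lemma spectral_radius_ge b d (Z : 'M[scalars R b]_d) (z : C) :
  eigenvalue (map_mx (@to_complex R b) Z) z -> normc z <= spectral_radius Z.
Proof.
move=> hz; apply: ub_le_sup; last by exists z.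
set Zc := map_mx _ Z in hz *.
have [s hs] := closed_field_poly_normal (char_poly Zc).
exists (\sum_(w <- s) normc w) => _ [w hw <-].
have ws : w \in s.
  move: hw; rewrite /= eigenvalue_root_char hs (monicP (char_poly_monic _)) scale1r.
  by rewrite root_prod_XsubC.
rewrite (big_rem w ws) /= lerDl sumr_ge0 // => y _; exact: normc_ge0.
Qed.

Lemma spectral_radius_ge0 b d (Z : 'M[scalars R b]_d) : 0 <= spectral_radius Z.
Proof.
have [[z hz]|no_ev] := pselect (exists z, eigenvalue (map_mx (@to_complex R b) Z) z).
  exact: le_trans (normc_ge0 z) (spectral_radius_ge hz).
(* There is no eigenvalue when the dimension is 0. *)
rewrite /spectral_radius; set E := (E in sup E); suff -> : E = set0 by rewrite sup0.
by apply/seteqP; split=> // w [z hz _]; apply: no_ev; exists z.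
Qed.

(** By Cayley-Hamilton the product of the factors [Z - z] over the roots of the
    characteristic polynomial kills the identity matrix. *)
Lemma complex_power_growth d (Z : 'M[C]_d) (r : R) :
  (forall z, eigenvalue Z z -> normc z < r) ->
  forall i j, exists M, forall p, normc ((Z ^+ p) i j) <= M * r ^+ p.
Proof.
case: d Z => [|d] Z hr i j; first by case: i.
have [s hs] := closed_field_poly_normal (char_poly Z).
move: hs; rewrite (monicP (char_poly_monic _)) scale1r => hs.
have [z zs|| M hM] := @annihilated_power_growth d Z s r _ 1 _ i j.
- by apply: hr; rewrite eigenvalue_root_char hs root_prod_XsubC.
- by rewrite -hs Cayley_Hamilton mul0r.
- by exists M => p; have := hM p; rewrite mulr1.
Qed.

Lemma rnorm_normc b (x : scalars R b) : rnorm x = normc (to_complex x).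
Proof.
by rewrite /rnorm to_complex_norm normc_def /=; case: (to_complex x).
Qed.

Lemma mxexp_growth b d (Z : 'M[scalars R b]_d) (r : R) :
  spectral_radius Z < r -> exists M, forall p, rnorm (Z ^+ p) <= M * r ^+ p.
Proof.
move=> hr; set Zc := map_mx (@to_complex R b) Z.
have r0 : 0 <= r by apply: le_trans (ltW hr); exact: spectral_radius_ge0.
have ZcE p : Zc ^+ p = map_mx (@to_complex R b) (Z ^+ p).
  elim: p => [|p IH]; first by rewrite !expr0 -[RHS]/(map_mx _ 1%:M) map_mx1.
  by rewrite !exprS IH -[RHS]/(map_mx _ (_ *m _)) map_mxM.
have : forall ij : 'I_d * 'I_d, exists M, forall p,
    rnorm ((Z ^+ p) ij.1 ij.2) <= M * r ^+ p.
  move=> [i j]; have [|M hM] := @complex_power_growth d Zc r _ i j.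
    by move=> z /spectral_radius_ge hz; exact: le_lt_trans hz hr.
  by exists M => p; have := hM p; rewrite ZcE mxE rnorm_normc.
move=> /choice [f hf]; exists (\sum_ij `|f ij|) => p.
apply: rnorm_mx_le => [|i j].
  by rewrite mulr_ge0 ?exprn_ge0 // sumr_ge0.
apply: le_trans (hf (i, j) p) _; rewrite ler_wpM2r ?exprn_ge0 //.
rewrite (bigD1 (i, j)) //=; apply: le_trans (ler_norm _) _.
by rewrite lerDl sumr_ge0.
Qed.

(** With [r] strictly between the spectral radius and a point of convergence,
    the terms are [O(|a_p| r^p)], and real power series converge absolutely inside
    their disc. *)
Lemma mx_pseries_cvg b d (a : nat -> R) (Z : 'M[scalars R b]_d) :
  ((spectral_radius Z)%:E < convergence_radius a)%E ->
  series (fun p => of_real b (a p) *: Z ^+ p) @ \oo --> mx_pseries a Z.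
Proof.
move=> /ereal_sup_gt [_ [r1 [r10 hr1] <-]]; rewrite lte_fin => hZ.
have [zr rr1] := midf_lt hZ; set r := (_ / _) in zr rr1.
have r0 : 0 <= r by apply: le_trans (ltW zr); exact: spectral_radius_ge0.
have [M hM] := mxexp_growth zr.
have ha : cvgn (pseries (fun p => `|a p|) r).
  by apply: is_cvg_pseries_inside_norm hr1 _; rewrite !ger0_norm.
apply: cvg_series_mx.
apply: (@series_le_cvg _ _ (fun p => M * (`|a p| * r ^+ p))) => [p|p|p|].
- exact: rnorm_ge0.
- by rewrite mulrCA mulr_ge0 // (le_trans _ (hM p)) // rnorm_ge0.
- by rewrite rnormZ rnorm_of_real mulrCA ler_wpM2l.
- exact: (@is_cvg_seriesZ R _ M ha).
Qed.

End PowerGrowth.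

(** * The matrix exponential *)

Section FallingFactorial.
Variable R : realType.

Lemma ffact_ratioS m p : (m.+1 ^_ p.+1)%:R / m.+1%:R ^+ p.+1 =
  (m.+1 ^_ p)%:R / m.+1%:R ^+ p * ((m.+1 - p)%N%:R / m.+1%:R) :> R.
Proof. by rewrite ffactnSr natrM exprSr invfM mulrACA. Qed.

Lemma ffact_ratio_le1 m p : (m.+1 ^_ p)%:R / m.+1%:R ^+ p <= 1 :> R.
Proof.
elim: p => [|p IH]; first by rewrite ffactn0 expr0 divr1.
rewrite ffact_ratioS mulr_ile1 ?divr_ge0 ?exprn_ge0 //.
by rewrite ler_pdivrMr // mul1r ler_nat leq_subr.
Qed.

Lemma cvg_ffact_ratio p :
  (m.+1 ^_ p)%:R / m.+1%:R ^+ p @[m --> \oo] --> (1 : R).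
Proof.
elim: p => [|p IH].
  by under eq_fun do rewrite ffactn0 expr0 divr1; exact: cvg_cst.
have h : 1 - p%:R * harmonic m @[m --> \oo] --> (1 - p%:R * 0 : R).
  apply: cvgB; first exact: cvg_cst.
  by apply: cvgM; [exact: cvg_cst | exact: cvg_harmonic].
rewrite mulr0 subr0 in h.
have h' : (m.+1 - p)%N%:R / m.+1%:R @[m --> \oo] --> (1 : R).
  apply: cvg_trans h; apply: near_eq_cvg; near=> m.
  have pm : (p <= m.+1)%N by apply: leqW; near: m; exact: nbhs_infty_ge.
  by rewrite natrB // mulrBl divff // pnatr_eq0.
have h2 := cvgM IH h'; rewrite mulr1 in h2.
by under eq_fun do rewrite ffact_ratioS; exact: h2.
Unshelve. all: by end_near. Qed.

End FallingFactorial.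

Section Exponential.
Variables (R : realType) (b : base_field) (d : nat).
Local Notation K := (scalars R b).
Local Notation M := 'M[K]_d.
Local Notation "t %:K" := (of_real b t) (at level 2).
Implicit Types A B : M.

Lemma mxexpZ (k : K) A p : (k *: A) ^+ p = k ^+ p *: A ^+ p.
Proof.
elim: p => [|p IH]; first by rewrite !expr0 scale1r.
by rewrite !exprS IH -[LHS]scalemxAl -scalemxAr scalerA.
Qed.

Lemma rnorm_exp_term A p c : d%:R * rnorm A <= c ->
  rnorm ((p`!%:R^-1)%:K *: A ^+ p) <= exp_coeff c p.
Proof.
move=> Ac; rewrite rnormZ rnorm_of_real ger0_norm ?invr_ge0 // exp_coeffE.
rewrite ler_wpM2l ?invr_ge0 //; apply: le_trans (rnorm_mxexp _ _) _.
by rewrite lerXn2r // nnegrE ?(le_trans _ Ac) // mulr_ge0 ?rnorm_ge0.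
Qed.

Lemma cvg_of_real T (F : set_system T) {FF : Filter F} (u : T -> R) (t : R) :
  u @ F --> t -> (u x)%:K @[x --> F] --> t%:K.
Proof.
move=> /cvgr_dist_lt h; apply/(@cvg_rnormP R b K^o)/cvgrPdist_lt => e /h.
by apply: filterS => x; rewrite sub0r normrN -rmorphB rnorm_of_real normr_id.
Qed.

Lemma expmx_cvg A :
  series (fun p => (p`!%:R^-1)%:K *: A ^+ p) @ \oo --> expmx A.
Proof.
apply: cvg_series_mx.
apply: series_le_cvg (is_cvg_series_exp_coeff (d%:R * rnorm A)) => p.
- exact: rnorm_ge0.
- by rewrite exp_coeff_ge0 // mulr_ge0 ?rnorm_ge0.
- exact: rnorm_exp_term.
Qed.

Lemma cvg_seq_rnorm_bounded (A_ : nat -> M) A :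
  A_ @ \oo --> A -> exists c, forall m, rnorm (A_ m) <= c.
Proof.
move=> /cvg_rnorm h.
have /cvg_seq_bounded [c [_ hc]] := cvgP _ h.
exists (c + 1) => m; have := hc (c + 1); rewrite ltrDl ltr01 => /(_ erefl m I).
by rewrite /= ger0_norm // rnorm_ge0.
Qed.

Lemma cvg_expmx (A_ : nat -> M) A :
  A_ @ \oo --> A -> expmx (A_ m) @[m --> \oo] --> expmx A.
Proof.
move=> hA; have [c hc] := cvg_seq_rnorm_bounded hA.
apply: (tannery (F := fun m p => (p`!%:R^-1)%:K *: A_ m ^+ p)
  (c := exp_coeff (d%:R * c)) _ _ _ _ (@expmx_cvg A)) => [m p||p|m].
- by apply: rnorm_exp_term; rewrite ler_wpM2l.
- exact: is_cvg_series_exp_coeff.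
- by apply: cvgZ; [exact: cvg_cst | exact: cvg_mxexp].
- exact: expmx_cvg.
Qed.

(** The term of degree [p] of the binomial expansion is [A_m^p / p!] times the
    ratio [n (n-1) ... (n-p+1) / n^p] with [n = m + 1]. That ratio is at most 1
    and tends to 1, so the exponential series dominates and is the limit. *)
Lemma cvg_compound (A_ : nat -> M) A : A_ @ \oo --> A ->
  (1 + (m.+1%:R^-1)%:K *: A_ m) ^+ m.+1 @[m --> \oo] --> expmx A.
Proof.
move=> hA; have [c hc] := cvg_seq_rnorm_bounded hA.
pose q m p : R := (m.+1 ^_ p)%:R / m.+1%:R ^+ p.
pose F m p := (q m p)%:K *: ((p`!%:R^-1)%:K *: A_ m ^+ p).
have FE m p : F m p = ((m.+1%:R^-1)%:K *: A_ m) ^+ p *+ 'C(m.+1, p).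
  rewrite /F /q mxexpZ scalerA scalerMnl; congr (_ *: _).
  rewrite -[RHS]mulr_natr -(rmorph_nat (@of_real R b)).
  rewrite -(rmorphXn (@of_real R b)) -!(rmorphM (@of_real R b)) /=.
  congr (_%:K); have pf : p`!%:R != 0 :> R by rewrite pnatr_eq0 -lt0n fact_gt0.
  by rewrite -bin_ffact natrM exprVn [LHS]mulrAC mulfK // mulrC.
apply: (tannery (F := F) (c := exp_coeff (d%:R * c)) _ _ _ _ (@expmx_cvg A)) => [m p||p|m].
- rewrite rnormZ rnorm_of_real ger0_norm ?divr_ge0 ?exprn_ge0 //.
  rewrite -[leRHS]mul1r ler_pM ?divr_ge0 ?exprn_ge0 ?rnorm_ge0 ?ffact_ratio_le1 //.
  by apply: rnorm_exp_term; rewrite ler_wpM2l.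
- exact: is_cvg_series_exp_coeff.
- rewrite -[L in _ --> L]scale1r -(rmorph1 (@of_real R b)).
  apply: cvgZ; first by apply: cvg_of_real; exact: cvg_ffact_ratio.
  by apply: cvgZ; [exact: cvg_cst | exact: cvg_mxexp].
- apply: cvg_near_cst; near=> n.
  have mn : (m.+2 <= n)%N by near: n; exact: nbhs_infty_ge.
  rewrite /series /= (big_cat_nat (n := m.+2)) //=.
  rewrite [X in _ + X]big_nat [X in _ + X]big1 ?addr0.
    rewrite [1 + _]addrC exprD1n big_mkord; apply: eq_bigr => i _; exact: FE.
  by move=> i /andP[mi _]; rewrite FE bin_small ?mulr0n.
Unshelve. all: by end_near. Qed.

Lemma cvg_compound_cst A :
  (1 + (m.+1%:R^-1)%:K *: A) ^+ m.+1 @[m --> \oo] --> expmx A.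
Proof. by apply: (@cvg_compound (fun=> A)); exact: cvg_cst. Qed.

Lemma expmx0 : expmx (0 : M) = 1.
Proof.
apply: norm_cvg_unique (@cvg_compound_cst 0) _ => /=.
by under eq_fun do rewrite scaler0 addr0 expr1n; exact: cvg_cst.
Qed.

Lemma cvg_harmonic_scale A : (m.+1%:R^-1)%:K *: A @[m --> \oo] --> (0 : M).
Proof.
rewrite -[L in _ --> L](scale0r A) -(rmorph0 (@of_real R b)).
by apply: cvgZ; [apply: cvg_of_real; exact: cvg_harmonic | exact: cvg_cst].
Qed.

(** The product [(1 + A/n)^n (1 - A/n)^n] equals [(1 + (- A^2/n)/n)^n], and
    [- A^2/n] tends to 0, so by [cvg_compound] the limit is [exp 0 = 1]. *)
Lemma expmxN A : expmx A *m expmx (- A) = 1%:M.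
Proof.
have h := cvg_mulmx (@cvg_compound_cst A) (@cvg_compound_cst (- A)).
have h1 := @cvg_compound _ _ (@cvg_harmonic_scale (- (A * A))).
rewrite expmx0 in h1; apply: (norm_cvg_unique (h _)).
suff hm m : (1 + (m.+1%:R^-1)%:K *: A) ^+ m.+1 *m
            (1 + (m.+1%:R^-1)%:K *: - A) ^+ m.+1 =
    (1 + (m.+1%:R^-1)%:K *: ((m.+1%:R^-1)%:K *: - (A * A))) ^+ m.+1.
  by rewrite /=; under eq_fun do rewrite hm; exact: h1.
rewrite -[LHS]/(_ ^+ _ * _ ^+ _) scalerN; set X := _ *: A.
have XX : X * X = (m.+1%:R^-1)%:K *: ((m.+1%:R^-1)%:K *: (A * A)).
  by rewrite -[LHS]scalemxAl -scalemxAr.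
rewrite -exprMn_comm; last by apply: commrD; [exact: commr1|apply: commrN;
  apply: commr_sym; apply: commrD; [exact: commr1|exact: commr_refl]].
by rewrite mulrDl mul1r mulrBr mulr1 addrA subrK XX !scalerN.
Qed.

Lemma expmx_unit A : expmx A \in unitmx.
Proof. by have [] := mulmx1_unit (expmxN A). Qed.

Lemma series_shift (V : zmodType) (u : nat -> V) n :
  series (fun p => u p.+1) n = series u n.+1 - u 0%N.
Proof. by rewrite /series /= big_nat_recl // addrC addKr. Qed.

(** The derivative of [exp (t A)] at 0, along [t = 1/n]: the term of degree
    [p + 1] carries the factor [n^-p], so that only the linear one survives. *)
Lemma cvg_expmx_deriv A :
  (m.+1%:R)%:K *: (expmx ((m.+1%:R^-1)%:K *: A) - 1) @[m --> \oo] --> A.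
Proof.
pose E p := (p`!%:R^-1)%:K *: A ^+ p.
pose F m p := ((m.+1%:R^-1) ^+ p)%:K *: E p.+1.
pose L p := if p is 0%N then A else 0.
have FE m p : F m p = (m.+1%:R)%:K *:
    ((p.+1`!%:R^-1)%:K *: ((m.+1%:R^-1)%:K *: A) ^+ p.+1).
  have m0 : (m.+1%:R : R) != 0 by rewrite pnatr_eq0.
  rewrite /F /E mxexpZ !scalerA; congr (_ *: _).
  rewrite -(rmorphXn (@of_real R b)) -!(rmorphM (@of_real R b)) /=.
  by congr (of_real b _); rewrite exprS [RHS]mulrACA divff // mul1r mulrC.
apply: (tannery (F := F) (L := L) (c := fun p => exp_coeff (d%:R * rnorm A) p.+1)).
- move=> m p; rewrite rnormZ rnorm_of_real ger0_norm ?exprn_ge0 ?invr_ge0 //.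
  rewrite -[leRHS]mul1r ler_pM ?rnorm_ge0 ?exprn_ge0 ?invr_ge0 ?rnorm_exp_term //.
  by rewrite exprn_ile1 ?invr_ge0 // invf_le1 ?ler1n.
- set e := exp_coeff _.
  have /cvg_ex [l hl] : cvgn (series e) by exact: is_cvg_series_exp_coeff.
  rewrite (_ : series _ = fun n => series e n.+1 - e 0%N); last first.
    by apply/funext => n; rewrite -series_shift.
  apply/cvg_ex; exists (l - e 0%N); apply: cvgB; last exact: cvg_cst.
  by rewrite (cvg_shiftS (series e)).
- case=> [|p] /=.
    have E1 : E 1%N = A by rewrite /E factS fact0 muln1 invr1 rmorph1 scale1r expr1.
    by under eq_fun do rewrite /F expr0 rmorph1 scale1r E1; exact: cvg_cst.
  rewrite -[L in _ --> L](scale0r (E p.+2)) -(rmorph0 (@of_real R b)).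
  apply: cvgZ; last exact: cvg_cst.
  apply: cvg_of_real; under eq_fun do rewrite exprS.
  have h : m.+1%:R^-1 * m.+1%:R^-1 ^+ p @[m --> \oo] --> (0 * 0 ^+ p : R).
    apply: cvgM; first exact: cvg_harmonic.
    exact: (cvg_comp _ _ cvg_harmonic (@exprn_continuous R p 0)).
  by rewrite mul0r in h; exact: h.
- move=> m.
  set B := _ *: A; pose e p := (p`!%:R^-1)%:K *: B ^+ p.
  rewrite (_ : series (F m) = fun n => (m.+1%:R)%:K *: (series e n.+1 - 1)); last first.
    have e0 : e 0%N = 1 by rewrite /e fact0 invr1 rmorph1 scale1r expr0.
    apply/funext => n; rewrite -e0 -series_shift /series /= scaler_sumr.
    by apply: eq_bigr => p _; rewrite FE.
  apply: cvgZ; first exact: cvg_cst.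
  apply: cvgB; last exact: cvg_cst.
  by rewrite (cvg_shiftS (series e)); exact: expmx_cvg.
- apply: cvg_near_cst; near=> n.
  have n0 : (0 < n)%N by near: n; exact: nbhs_infty_gt.
  rewrite /series /= -(prednK n0) big_nat_recl // big1 ?addr0 //.
Unshelve. all: by end_near. Qed.
End Exponential.

(** * The Lie algebra of a matrix Lie group *)

Lemma invmx_eq (F : fieldType) n (A B : 'M[F]_n) :
  A *m B = 1%:M -> invmx A = B.
Proof.
by move=> AB; have [uA _] := mulmx1_unit AB; rewrite -(mulKmx uA B) AB mulmx1.
Qed.

Lemma invmxM (F : fieldType) n (A B : 'M[F]_n) :
  A \in unitmx -> B \in unitmx -> invmx (A *m B) = invmx B *m invmx A.
Proof.
by move=> uA uB; apply: invmx_eq; rewrite mulmxA mulmxK // mulmxV.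
Qed.

Lemma invmxX (F : fieldType) n (A : 'M[F]_n) p :
  A \in unitmx -> invmx (A ^+ p) = invmx A ^+ p.
Proof.
move=> uA; apply: invmx_eq.
have AV : A * invmx A = 1 by exact: mulmxV.
have VA : invmx A * A = 1 by exact: mulVmx.
rewrite -[LHS]/(_ ^+ _ * _ ^+ _) -exprMn_comm ?AV ?expr1n //.
by rewrite /GRing.comm AV VA.
Qed.

Section LieAlgebra.
Variables (R : realType) (b : base_field) (d : nat).
Variable G : set 'M[scalars R b]_d.
Hypothesis hG : matrix_lie_group G.
Local Notation "t %:K" := (of_real b t) (at level 2).
Local Notation g := (lie_algebra G).
Implicit Types A B Z : 'M[scalars R b]_d.

Lemma mlg_cvg (A_ : nat -> 'M[scalars R b]_d) A :
  A_ @ \oo --> A -> (forall m, G (A_ m)) -> A \in unitmx -> G A.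
Proof.
move=> hA GA uA; have [F clF GF] := mlg_closed hG.
rewrite GF; split=> //; apply: (closed_cvg F clF _ _ hA).
by apply: nearW => m; have := GA m; rewrite GF => -[].
Qed.

Lemma mlg_exp Z p : G Z -> G (Z ^+ p).
Proof.
move=> GZ; elim: p => [|p IH]; first exact: mlg_one hG.
by rewrite exprS; exact: mlg_mul.
Qed.

Lemma lie_algebraZ (t : R) A : g A -> g (t%:K *: A).
Proof. by move=> gA s; rewrite scalerA -rmorphM; exact: gA. Qed.

Lemma lie_algebra0 : g 0.
Proof. by move=> t; rewrite scaler0 expmx0; exact: mlg_one hG. Qed.

Lemma lie_algebra_cvg (A_ : nat -> 'M[scalars R b]_d) A :
  A_ @ \oo --> A -> (forall m, g (A_ m)) -> g A.
Proof.
move=> hA gA t; apply: mlg_cvg (expmx_unit _).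
  by apply: cvg_expmx; apply: cvgZ; [exact: cvg_cst | exact: hA].
by move=> m; exact: gA.
Qed.

(** The Lie product formula: with [n = m + 1], [D m] below is
    [n (exp(tA/n) exp(tB/n) - 1)], which tends to [tA + tB], and
    [(1 + D m / n)^n] lies in the group. *)
Lemma lie_algebraD A B : g A -> g B -> g (A + B).
Proof.
move=> gA gB t; rewrite scalerDr; set A' := _ *: A; set B' := _ *: B.
pose eA m := expmx ((m.+1%:R^-1)%:K *: A').
pose eB m := expmx ((m.+1%:R^-1)%:K *: B').
have GA m : G (eA m) by rewrite /eA scalerA -rmorphM; exact: gA.
have GB m : G (eB m) by rewrite /eB scalerA -rmorphM; exact: gB.
pose D m := (m.+1%:R)%:K *: (eA m *m eB m - 1).
have hD : D @ \oo --> A' + B'.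
  have hB1 : eB @ \oo --> (1 : 'M[scalars R b]_d).
    rewrite -(expmx0 R b d); apply: cvg_expmx; exact: cvg_harmonic_scale.
  have DE m : D m = (m.+1%:R)%:K *: (eA m - 1) *m eB m + (m.+1%:R)%:K *: (eB m - 1).
    by rewrite -scalemxAl -scalerDr mulmxBl mul1mx addrA subrK.
  have h : (m.+1%:R)%:K *: (eA m - 1) *m eB m + (m.+1%:R)%:K *: (eB m - 1)
      @[m --> \oo] --> A' *m 1%:M + B'.
    apply: cvgD; last exact: (@cvg_expmx_deriv R b d B').
    by apply: cvg_mulmx => //; exact: (@cvg_expmx_deriv R b d A').
  by rewrite mulmx1 in h; rewrite (funext DE); exact: h.
apply: mlg_cvg (cvg_compound hD) _ (expmx_unit _) => m; apply: mlg_exp.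
rewrite /D scalerA -rmorphM mulVf ?pnatr_eq0 // rmorph1 scale1r addrC subrK.
exact: mlg_mul.
Qed.

Lemma lie_algebra_sum (I : Type) (r : seq I) (P : pred I) F :
  (forall i, P i -> g (F i)) -> g (\sum_(i <- r | P i) F i).
Proof.
move=> h; elim/big_ind: _ => //; [exact: lie_algebra0 | exact: lie_algebraD].
Qed.

(** The p-th term of the difference of the two series is a multiple of
    [Z^p - (Z^p)^-1], and [Z^p] is again in the group. *)
Lemma lie_algebra_pseries_diff (a : nat -> R) Z : lohe_closure G ->
  (forall Z, G Z -> ((spectral_radius Z)%:E < convergence_radius a)%E) ->
  G Z -> g (mx_pseries a Z - mx_pseries a (invmx Z)).
Proof.
move=> hL ha GZ; have GV := mlg_inv hG GZ.
apply: (lie_algebra_cvg (cvgB (mx_pseries_cvg (ha _ GZ)) (mx_pseries_cvg (ha _ GV)))).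
move=> n; rewrite -[_ n]/(series _ n - series _ n) /series /= -sumrB.
apply: lie_algebra_sum => p _; rewrite -scalerBr; apply: lie_algebraZ.
by rewrite -invmxX ?(mlg_unit hG) //; apply: hL; exact: mlg_exp.
Qed.

Lemma norm_on_sum (N : 'M[scalars R b]_d -> R) (I : Type) (r : seq I) F :
  norm_on g N -> (forall i, g (F i)) ->
  N (\sum_(i <- r) F i) <= \sum_(i <- r) N (F i).
Proof.
move=> hN gF; elim: r => [|i r IH].
  by rewrite !big_nil -(scale0r 0) -(rmorph0 (@of_real R b)) (norm_onZ hN)
     ?normr0 ?mul0r //; exact: lie_algebra0.
rewrite !big_cons; apply: le_trans (norm_onD hN _ _) _ => //.
  exact: lie_algebra_sum.
by rewrite lerD2l.
Qed.

End LieAlgebra.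

(** * The bound on the vector field *)

Theorem proposition3p2 (R : realType) (b : base_field) (d n : nat)
    (G : set 'M[scalars R b]_d) (hG : matrix_lie_group G)
    (hLohe : lohe_closure G)
    (Gamma : weighted_graph R n)
    (a : nat -> R) (a0 : a 0%N = 0)
    (ha : forall Z, G Z -> ((spectral_radius Z)%:E < convergence_radius a)%E)
    (N : 'M[scalars R b]_d -> R) (hN : norm_on (lie_algebra G) N)
    (C : R)
    (hC : forall Z, G Z -> N (mx_pseries a Z - mx_pseries a (invmx Z)) <= C)
    (X : 'I_n -> 'M[scalars R b]_d) (hX : forall i, G (X i)) :
  max_norm N (lohe_field Gamma (mx_pseries a) X) <=
    C / 2 * mx_norm_infty Gamma.
Proof.
have gdiff Z : G Z -> lie_algebra G (mx_pseries a Z - mx_pseries a (invmx Z)).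
  exact: lie_algebra_pseries_diff.
(* The hypothesis on C at the identity matrix. *)
have C0 : 0 <= C.
  have G1 := mlg_one hG; exact: le_trans (norm_on_ge0 hN (gdiff _ G1)) (hC _ G1).
have C20 : 0 <= C / 2 by rewrite divr_ge0.
have M0 : 0 <= mx_norm_infty Gamma.
  by apply: bigmax_ge_id.
apply: bigmax_le => [|i _]; first by rewrite mulr_ge0.
have GX j : G (X j *m invmx (X i)) by apply: mlg_mul => //; exact: mlg_inv.
have XV j : X i *m invmx (X j) = invmx (X j *m invmx (X i)).
  by rewrite invmxM ?unitmx_inv ?invmxK // (mlg_unit hG).
have gF j : lie_algebra G (of_real b (Gamma i j) *:
    (mx_pseries a (X j *m invmx (X i)) - mx_pseries a (X i *m invmx (X j)))).
  by apply: lie_algebraZ; rewrite XV; exact: gdiff.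
rewrite /lohe_field (norm_onZ hN); last exact: lie_algebra_sum.
rewrite ger0_norm ?invr_ge0 // [leRHS]mulrAC [leRHS]mulrC ler_wpM2l ?invr_ge0 //.
apply: le_trans (norm_on_sum hG _ hN gF) _.
apply: (@le_trans _ _ (C * \sum_(j < n) `|Gamma i j|)).
  rewrite mulr_sumr; apply: ler_sum => j _.
  rewrite XV (norm_onZ hN _ (gdiff _ (GX j))) mulrC.
  by apply: ler_wpM2r; [exact: normr_ge0 | exact: hC].
apply: ler_wpM2l => //.
exact: (le_bigmax 0 (fun i => \sum_(j < n) `|Gamma i j|) i).
Qed.
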